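(* Let $f:\mathbb{R}\to\mathbb{R}$ be analytic with $f(x)=\sum_{i\ge 0}a_i x^i$, let $N\ge 1$ and $\alpha>0$, and consider the extended system on $\mathbb{R}^N$ $$\frac{d\vec X}{dt}=\boldsymbol{\Omega}_1\vec F(\vec X)-\alpha(\boldsymbol{I}-\boldsymbol{\Omega}_1)\vec X ,$$ where $\vec F$ is either the standard commuting map $\vec F(\vec X)=\sum_{i\ge 0}a_i\boldsymbol{X}^i\vec 1$ or the standard non-commuting map $\vec F(\vec X)=\sum_{i\ge 0}a_i(\boldsymbol{\Omega}_1\boldsymbol{X})^i\vec 1$. Then, for both maps, the extended system has the same fixed points (if they exist) as the target system $dx/dt=f(x)$, in the sense that $\vec X^*\in\mathbb{R}^N$ is a fixed point of the extended system if and only if $\vec X^*=x^*\vec 1$ for some $x^*\in\mathbb{R}$ with $f(x^* )=0$.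
   Context: $\vec 1\in\mathbb{R}^N$ is the all-ones column vector, $\boldsymbol{I}$ the $N\times N$ identity matrix, and $\boldsymbol{\Omega}_1$ (the uniform mean-field projector) is the $N\times N$ matrix all of whose entries equal $1/N$. For $\vec X=(X_1,\dots,X_N)\in\mathbb{R}^N$, $\boldsymbol{X}=\mathrm{diag}(X_1,\dots,X_N)$. A matrix to the power zero is the identity. The power series of $f$ is assumed to represent $f$ on all of $\mathbb{R}$. *)

(* Defs.v *)
From mathcomp Require Import all_boot all_order all_algebra.
From mathcomp Require Import all_classical all_reals all_analysis.

Set Implicit Arguments.
Unset Strict Implicit.
Unset Printing Implicit Defensive.

Import Order.TTheory GRing.Theory Num.Theory.
Import numFieldNormedType.Exports.
Local Open Scope classical_set_scope.
Local Open Scope ring_scope.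

Section ExtendedSystem.
Variables (R : realType) (N : nat).

Definition ones : 'cV[R]_N := const_mx 1.

Definition mean_field_projector : 'M[R]_N := const_mx (N%:R^-1).

(* Sum of the vector series a_0 A^0 1 + a_1 A^1 1 + ..., as the limit of its
   partial sums for the usual topology of R^N. *)
Definition power_series_at_ones (a : nat -> R) (A : 'M[R]_N) : 'cV[R]_N :=
  lim (series (fun i => a i *: (A ^+ i *m ones)) @ \oo).

Definition commuting_map (a : nat -> R) (X : 'cV[R]_N) : 'cV[R]_N :=
  power_series_at_ones a (diag_mx X^T).

Definition noncommuting_map (a : nat -> R) (X : 'cV[R]_N) : 'cV[R]_N :=
  power_series_at_ones a (mean_field_projector *m diag_mx X^T).

Definition extended_field (alpha : R) (F : 'cV[R]_N -> 'cV[R]_N)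
    (X : 'cV[R]_N) : 'cV[R]_N :=
  mean_field_projector *m F X - alpha *: ((1%:M - mean_field_projector) *m X).

End ExtendedSystem.

Arguments ones {R N}.
Arguments mean_field_projector {R N}.

(* Fixed point of the autonomous ODE dx/dt = G x (not of the map G). *)
Definition ode_fixed_point (V : zmodType) (G : V -> V) (x : V) : Prop :=
  G x = 0.

(* Main.v *)
(* If G is the extended field then Omega *m G X = Omega *m F X, because
   Omega (I - Omega) = 0.  Hence at a fixed point both summands of G vanish,
   and the second one forces X to be a multiple x *: ones of the all-ones
   vector.  On such X both matrices defining F have ones as an eigenvector for
   the eigenvalue x, so that F X = f x *: ones. *)
Require Import Defs.
From mathcomp Require Import all_boot all_order all_algebra.
From mathcomp Require Import all_classical all_reals all_analysis.
Import Order.TTheory GRing.Theory Num.Theory.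
Import numFieldNormedType.Exports.
Local Open Scope classical_set_scope.
Local Open Scope ring_scope.

Lemma expmx_eigen {R : comPzRingType} {N : nat} {A : 'M[R]_N} {v : 'cV[R]_N}
    {x : R} (Av : A *m v = x *: v) (i : nat) : A ^+ i *m v = x ^+ i *: v.
Proof.
elim: i => [|i IH]; first by rewrite !expr0 mul1mx scale1r.
by rewrite exprSr -mulmxE -mulmxA Av -scalemxAr IH scalerA -exprS.
Qed.

(** On an eigenvector each partial sum of the vector series is the scalar partial sum at the
    eigenvalue times [ones], and scaling a fixed vector is continuous. *)
Lemma power_series_at_ones_eigen {R : realType} {N : nat} {a : nat -> R}
    {A : 'M[R]_N} {x y : R} :
  A *m ones = x *: ones -> series (fun i => a i * x ^+ i) @ \oo --> y ->
  power_series_at_ones a A = y *: ones.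
Proof.
move=> A1 axy; rewrite /power_series_at_ones.
have -> : series (fun i => a i *: (A ^+ i *m ones)) =
    (fun n => series (fun i => a i * x ^+ i) n *: (ones : 'cV[R]_N)).
  apply/funext => n; rewrite /series /= scaler_suml.
  by apply: eq_bigr => i _; rewrite (expmx_eigen A1) scalerA.
(* Limits are unique in a Hausdorff space, so convergence identifies the value of [lim]. *)
apply: cvg_lim; first exact: norm_hausdorff.
exact: cvgZr_tmp axy.
Qed.

Section MeanField.
Context {R : realType} {N : nat}.
Implicit Types X : 'cV[R]_N.

Lemma mean_field_projectorE X :
  mean_field_projector *m X = (N%:R^-1 * \sum_i X i 0) *: ones.
Proof.
apply/matrixP => i j; rewrite ord1 !mxE mulr1 mulr_sumr.
by apply: eq_bigr => k _; rewrite !mxE.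
Qed.

Lemma diag_mx_scale_ones (x : R) :
  diag_mx (x *: ones : 'cV[R]_N)^T *m ones = x *: ones.
Proof. by apply/matrixP => i j; rewrite mul_diag_mx !mxE !mulr1. Qed.

Hypothesis N_gt0 : (0 < N)%N.

Lemma mean_field_projector_ones :
  mean_field_projector *m ones = ones :> 'cV[R]_N.
Proof.
rewrite mean_field_projectorE (eq_bigr (fun=> 1)) => [|i _]; last by rewrite mxE.
by rewrite sumr_const card_ord mulVf ?scale1r// pnatr_eq0 -lt0n.
Qed.

Lemma mean_field_projector_idem X :
  mean_field_projector *m (mean_field_projector *m X) =
  mean_field_projector *m X.
Proof.
by rewrite (mean_field_projectorE X) -scalemxAr mean_field_projector_ones.
Qed.

(** [F] stays abstract, known only on the line spanned by [ones], so that one argument serves both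
    maps. *)
Lemma extended_fixed_point_iff (f : R -> R) (alpha : R)
    (F : 'cV[R]_N -> 'cV[R]_N) X :
  alpha != 0 -> (forall x, F (x *: ones) = f x *: ones) ->
  ode_fixed_point (extended_field alpha F) X <->
  exists x : R, X = x *: ones /\ ode_fixed_point f x.
Proof.
move=> alpha0 F1; rewrite /ode_fixed_point /extended_field mulmxBl mul1mx.
have G1 x : mean_field_projector *m F (x *: ones) = f x *: ones.
  by rewrite F1 -scalemxAr mean_field_projector_ones.
split=> [GX0|[x [-> fx0]]]; last first.
  rewrite G1 fx0 -scalemxAr mean_field_projector_ones subrr scaler0 scale0r.
  exact: subr0.
have PF0 : mean_field_projector *m F X = 0.
  have /= := congr1 (mulmx mean_field_projector) GX0.
  rewrite mulmxBr -scalemxAr mulmxBr !mean_field_projector_idem subrr.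
  by rewrite scaler0 subr0 mulmx0.
move: GX0; rewrite PF0 sub0r => /eqP.
rewrite oppr_eq0 scaler_eq0 (negPf alpha0) subr_eq0 => /eqP.
(* [X] is now fixed by the projector; the witness [x] is the mean of its entries. *)
rewrite mean_field_projectorE; set x := _ * _ => Xx.
(* [f x *: ones = 0] gives [f x = 0] by reading one entry, which exists since [N] is positive. *)
exists x; split=> //; move: PF0; rewrite Xx G1 => /matrixP/(_ (Ordinal N_gt0) 0).
by rewrite !mxE mulr1.
Qed.

End MeanField.

Theorem proposition3p3 (R : realType) (f : R -> R) (a : nat -> R)
    (hf : forall x : R, series (fun i => a i * x ^+ i) @ \oo --> f x)
    (N : nat) (hN : (0 < N)%N) (alpha : R) (halpha : 0 < alpha) :
  (forall X : 'cV[R]_N,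
     ode_fixed_point (extended_field alpha (commuting_map a)) X <->
     exists x : R, X = x *: ones /\ ode_fixed_point f x) /\
  (forall X : 'cV[R]_N,
     ode_fixed_point (extended_field alpha (noncommuting_map a)) X <->
     exists x : R, X = x *: ones /\ ode_fixed_point f x).
Proof.
split=> X; apply: extended_fixed_point_iff => //; rewrite ?gt_eqF// => x;
  apply: power_series_at_ones_eigen (hf x); first exact: diag_mx_scale_ones.
(* The diagonal factor acts first and yields [x *: ones], which the projector fixes. *)
by rewrite -mulmxA diag_mx_scale_ones -scalemxAr mean_field_projector_ones.
Qed.
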